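(* Consider the plant $x[t+1]=Ax[t]+Bu[t]+\delta_x[t]$, $y[t]=Cx[t]+\delta_y[t]$ in feedback with the dynamic controller $\xi[t+1]=A_k\xi[t]+B_ky[t]$, $u[t]=C_k\xi[t]+D_ky[t]+\delta_u[t]$. Assume that $(A,B)$ and $(A_k,B_k)$ are stabilizable and $(A,C)$ and $(A_k,C_k)$ are detectable. Then the following statements are equivalent: (1) $\mathbf{K}$ internally stabilizes $\mathbf{G}$; (2) the closed-loop transfer matrix from $(\delta_x,\delta_y)$ to $(\mathbf{y},\mathbf{u})$ is in $\mathcal{RH}_\infty$; (3) the closed-loop transfer matrix from $(\delta_x,\delta_y)$ to $(\mathbf{x},\mathbf{u})$ is in $\mathcal{RH}_\infty$; (4) the closed-loop transfer matrix from $(\delta_y,\delta_u)$ to $(\mathbf{y},\mathbf{u})$ is in $\mathcal{RH}_\infty$; (5) the closed-loop transfer matrix from $(\delta_y,\delta_u)$ to $(\mathbf{x},\mathbf{u})$ is in $\mathcal{RH}_\infty$. Moreover, the stability of any other group of four closed-loop responses obtained by choosing two of the disturbances $\delta_x,\delta_y,\delta_u$ and two of the signals $\mathbf{x},\mathbf{y},\mathbf{u}$ is not sufficient for internal stability. That is, for each of the five groups $(\delta_x,\delta_y)\to(\mathbf{x},\mathbf{y})$, $(\delta_y,\delta_u)\to(\mathbf{x},\mathbf{y})$, $(\delta_x,\delta_u)\to(\mathbf{x},\mathbf{y})$, $(\delta_x,\delta_u)\to(\mathbf{y},\mathbf{u})$, $(\delta_x,\delta_u)\to(\mathbf{x},\mathbf{u})$,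 there exist a plant and a controller with $(A,B)$ and $(A_k,B_k)$ stabilizable and $(A,C)$ and $(A_k,C_k)$ detectable for which the closed-loop transfer matrix of that group is in $\mathcal{RH}_\infty$ but $\mathbf{K}$ does not internally stabilize $\mathbf{G}$.
   Context: All systems are discrete-time, linear time-invariant with real matrices; $x[t]\in\mathbb{R}^n$, $u[t]\in\mathbb{R}^m$, $y[t]\in\mathbb{R}^p$, $\xi[t]\in\mathbb{R}^q$; $\delta_x,\delta_y,\delta_u$ are external disturbances. Boldface letters denote signals in the $z$-domain and transfer matrices: $\mathbf{G}=C(zI-A)^{-1}B$ and $\mathbf{K}=C_k(zI-A_k)^{-1}B_k+D_k$. The closed loop (always well-posed) is internally stable, equivalently $\mathbf{K}$ internally stabilizes $\mathbf{G}$, if $(x[t],\xi[t])\to 0$ as $t\to\infty$ for all initial states when $\delta_x,\delta_y,\delta_u$ are identically zero. $\mathcal{RH}_\infty$ is the set of real-rational proper stable transfer matrices (all poles of modulus $<1$). The closed-loop responses $\boldsymbol{\Phi}_{ab}$, from $\delta_b$ to signal $\mathbf{a}$ ($a,b\in\{x,y,u\}$), are: $\boldsymbol{\Phi}_{xx}=(zI-A-B\mathbf{K}C)^{-1}$, $\boldsymbol{\Phi}_{xy}=\boldsymbol{\Phi}_{xx}B\mathbf{K}$, $\boldsymbol{\Phi}_{xu}=\boldsymbol{\Phi}_{xx}B$, $\boldsymbol{\Phi}_{yx}=C\boldsymbol{\Phi}_{xx}$, $\boldsymbol{\Phi}_{yy}=C\boldsymbol{\Phi}_{xx}B\mathbf{K}+I$,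 $\boldsymbol{\Phi}_{yu}=C\boldsymbol{\Phi}_{xx}B$, $\boldsymbol{\Phi}_{ux}=\mathbf{K}C\boldsymbol{\Phi}_{xx}$, $\boldsymbol{\Phi}_{uy}=\mathbf{K}(C\boldsymbol{\Phi}_{xx}B\mathbf{K}+I)$, $\boldsymbol{\Phi}_{uu}=\mathbf{K}C\boldsymbol{\Phi}_{xx}B+I$. The closed-loop transfer matrix from $(\delta_b,\delta_{b'})$ to $(\mathbf{a},\mathbf{a}')$ is the block matrix $\begin{bmatrix}\boldsymbol{\Phi}_{ab}&\boldsymbol{\Phi}_{ab'}\\ \boldsymbol{\Phi}_{a'b}&\boldsymbol{\Phi}_{a'b'}\end{bmatrix}$. *)

(* Defs.v *)
From HB Require Import structures.
From mathcomp Require Import all_boot all_order all_algebra.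
From mathcomp Require Import all_classical all_reals all_analysis.
From mathcomp Require Import complex.

Set Implicit Arguments.
Unset Strict Implicit.
Unset Printing Implicit Defensive.

Import Order.TTheory GRing.Theory Num.Theory.
Import numFieldNormedType.Exports.
Local Open Scope classical_set_scope.
Local Open Scope ring_scope.

Definition schur (R : realType) (n : nat) (A : 'M[R]_n) : Prop :=
  forall l : R[i], eigenvalue (map_mx (real_complex R) A) l -> `|l| < 1.

Definition stabilizable (R : realType) (n m : nat)
    (A : 'M[R]_n) (B : 'M[R]_(n, m)) : Prop :=
  exists F : 'M[R]_(m, n), schur (A + B *m F).

Definition detectable (R : realType) (n p : nat)
    (A : 'M[R]_n) (C : 'M[R]_(p, n)) : Prop :=
  exists L : 'M[R]_(n, p), schur (A + L *m C).

Definition closed_loop (R : realType) (n m p q : nat)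
    (A : 'M[R]_n) (B : 'M[R]_(n, m)) (C : 'M[R]_(p, n))
    (Ak : 'M[R]_q) (Bk : 'M[R]_(q, p)) (Ck : 'M[R]_(m, q)) (Dk : 'M[R]_(m, p))
    (dx : nat -> 'cV[R]_n) (dy : nat -> 'cV[R]_p) (du : nat -> 'cV[R]_m)
    (x : nat -> 'cV[R]_n) (y : nat -> 'cV[R]_p) (u : nat -> 'cV[R]_m)
    (xi : nat -> 'cV[R]_q) : Prop :=
  forall t : nat,
    [/\ x t.+1 = A *m x t + B *m u t + dx t,
        y t = C *m x t + dy t,
        xi t.+1 = Ak *m xi t + Bk *m y t &
        u t = Ck *m xi t + Dk *m y t + du t].

(* The loop has no algebraic loop, so each initial state (x 0, xi 0) determines
   exactly one trajectory: quantifying over the undisturbed trajectories is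
   quantifying over all initial states. *)
Definition internally_stable (R : realType) (n m p q : nat)
    (A : 'M[R]_n) (B : 'M[R]_(n, m)) (C : 'M[R]_(p, n))
    (Ak : 'M[R]_q) (Bk : 'M[R]_(q, p)) (Ck : 'M[R]_(m, q))
    (Dk : 'M[R]_(m, p)) : Prop :=
  forall (x : nat -> 'cV[R]_n) (y : nat -> 'cV[R]_p)
         (u : nat -> 'cV[R]_m) (xi : nat -> 'cV[R]_q),
    closed_loop A B C Ak Bk Ck Dk
      (fun=> 0) (fun=> 0) (fun=> 0) x y u xi ->
    (x @ \oo --> (0 : 'cV[R]_n)) /\ (xi @ \oo --> (0 : 'cV[R]_q)).

(* The field R(z) of real rational functions; transfer matrices are matrices
   over it. *)
Definition ratfun (R : realType) : fieldType := {fraction {poly R}}.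

Definition zvar (R : realType) : ratfun R := tofrac ('X : {poly R}).

Definition constmx (R : realType) (m n : nat) (M : 'M[R]_(m, n)) :
    'M[ratfun R]_(m, n) :=
  map_mx (fun a : R => tofrac (a%:P) : ratfun R) M.

(* The poles are the complex roots of the denominator of a reduced form, which
   is unique up to a nonzero constant. *)
Definition proper_stable (R : realType) (f : ratfun R) : Prop :=
  exists num den : {poly R},
    [/\ den != 0, coprimep num den,
        f = tofrac num / tofrac den :> ratfun R,
        (size num <= size den)%N &
        forall s : R[i], root (map_poly (real_complex R) den) s -> `|s| < 1].

Definition RHoo (R : realType) (m n : nat) (M : 'M[ratfun R]_(m, n)) : Prop :=
  forall i j, proper_stable (M i j).

Definition transfer (R : realType) (n m p : nat)
    (A : 'M[R]_n) (B : 'M[R]_(n, m)) (C : 'M[R]_(p, n)) (D : 'M[R]_(p, m)) :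
    'M[ratfun R]_(p, m) :=
  constmx C *m invmx ((zvar R)%:M - constmx A) *m constmx B + constmx D.

Inductive channel := chx | chy | chu.

Definition chdim (n m p : nat) (a : channel) : nat :=
  match a with chx => n | chy => p | chu => m end.

(* [Phi .. a b] is the response from the disturbance on channel b to the signal
   of channel a.  The inverse defining Pxx exists: B K C is proper, so that
   z I - A - B K C = z (I - W) with W strictly proper.  Likewise for z I - Ak,
   so the value of [invmx] on singular matrices plays no role. *)
Definition Phi (R : realType) (n m p q : nat)
    (A : 'M[R]_n) (B : 'M[R]_(n, m)) (C : 'M[R]_(p, n))
    (Ak : 'M[R]_q) (Bk : 'M[R]_(q, p)) (Ck : 'M[R]_(m, q)) (Dk : 'M[R]_(m, p))
    (a b : channel) : 'M[ratfun R]_(chdim n m p a, chdim n m p b) :=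
  let B' := constmx B in
  let C' := constmx C in
  let K := transfer Ak Bk Ck Dk in
  let Pxx := invmx ((zvar R)%:M - constmx A - B' *m K *m C') in
  match a as a0, b as b0
    return 'M[ratfun R]_(chdim n m p a0, chdim n m p b0) with
  | chx, chx => Pxx
  | chx, chy => Pxx *m B' *m K
  | chx, chu => Pxx *m B'
  | chy, chx => C' *m Pxx
  | chy, chy => C' *m Pxx *m B' *m K + 1%:M
  | chy, chu => C' *m Pxx *m B'
  | chu, chx => K *m C' *m Pxx
  | chu, chy => K *m (C' *m Pxx *m B' *m K + 1%:M)
  | chu, chu => K *m C' *m Pxx *m B' + 1%:M
  end.

(* From the disturbances on channels (b, b') to the signals (a, a'). *)
Definition Phi4 (R : realType) (n m p q : nat)
    (A : 'M[R]_n) (B : 'M[R]_(n, m)) (C : 'M[R]_(p, n))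
    (Ak : 'M[R]_q) (Bk : 'M[R]_(q, p)) (Ck : 'M[R]_(m, q)) (Dk : 'M[R]_(m, p))
    (b b' a a' : channel) :
    'M[ratfun R]_(chdim n m p a + chdim n m p a',
                  chdim n m p b + chdim n m p b') :=
  block_mx (Phi A B C Ak Bk Ck Dk a b)  (Phi A B C Ak Bk Ck Dk a b')
           (Phi A B C Ak Bk Ck Dk a' b) (Phi A B C Ak Bk Ck Dk a' b').

(* The dimensions are required to be positive so that a counterexample cannot
   come from an empty state, input or output space. *)
Definition not_sufficient (R : realType) (b b' a a' : channel) : Prop :=
  exists (n m p q : nat)
    (A : 'M[R]_n) (B : 'M[R]_(n, m)) (C : 'M[R]_(p, n))
    (Ak : 'M[R]_q) (Bk : 'M[R]_(q, p)) (Ck : 'M[R]_(m, q)) (Dk : 'M[R]_(m, p)),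
    [/\ [/\ (0 < n)%N, (0 < m)%N, (0 < p)%N & (0 < q)%N],
        stabilizable A B /\ stabilizable Ak Bk,
        detectable A C /\ detectable Ak Ck,
        RHoo (Phi4 A B C Ak Bk Ck Dk b b' a a') &
        ~ internally_stable A B C Ak Bk Ck Dk].

(* Main.v *)
Require Import Defs.
From HB Require Import structures.
From mathcomp Require Import all_boot all_order all_algebra.
From mathcomp Require Import all_classical all_reals all_analysis.
From mathcomp Require Import complex.

(* With M = [[A + B Dk C, B Ck], [Bk C, Ak]] the closed-loop state matrix, every
   response has the form Phi_ab = out_a (z I - M)^-1 in_b + direct_ab with
   constant matrices.  Internal stability means that M is Schur, i.e. that
   (z I - M)^-1 is in RHoo, and then all responses are in RHoo.  Conversely,
   (M, [in_y in_u]) is stabilizable and (M, [out_y; out_u]) is detectable, so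
   that (z I - M)^-1 is recovered from the group (dy, du) -> (y, u) by two
   resolvent identities; the three other groups determine this one because
   Phi_au = Phi_ax B + const and Phi_yb = C Phi_xb + const.  Insufficiency of the
   remaining groups: they all omit Phi_uy, which for the zero plant is the only
   response that sees the controller. *)

Set Implicit Arguments.
Unset Strict Implicit.
Unset Printing Implicit Defensive.

Import Order.TTheory GRing.Theory Num.Theory.
Import numFieldNormedType.Exports.
Import ComplexField.
Local Open Scope ring_scope.

(** * Proper stable rational functions and resolvents *)

Section StableRationalFunctions.
Variable R : realType.
Local Notation toC := (real_complex R).

Definition disk_poly (d : {poly R}) : Prop :=
  forall s : R[i], root (map_poly toC d) s -> `|s| < 1.

Lemma disk_polyM (c d : {poly R}) :
  disk_poly c -> disk_poly d -> disk_poly (c * d).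
Proof.
by move=> hc hd s; rewrite rmorphM rootM => /orP[/hc | /hd].
Qed.

Lemma disk_poly_dvdl (c d : {poly R}) : disk_poly (c * d) -> disk_poly c.
Proof. by move=> hcd s hs; apply: hcd; rewrite rmorphM rootM hs. Qed.

(** Dividing both polynomials by their gcd lowers the two sizes equally and only removes roots of
    the denominator. Coprimality can therefore be dropped, and sums and products need no reduction
    to lowest terms. *)
Lemma proper_stableP (f : ratfun R) :
  proper_stable f <-> exists num den : {poly R},
    [/\ den != 0, tofrac den * f = tofrac num :> ratfun R,
        (size num <= size den)%N & disk_poly den].
Proof.
split=> [[n [d [d0 _ -> snd hd]]] | [n [d [d0 e snd hd]]]].
  exists n, d; split=> //.
  by rewrite mulrCA mulfV ?mulr1 // tofrac_eq0.
have g0 : gcdp n d != 0 by rewrite gcdp_eq0 (negPf d0) andbF.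
have en : n = n %/ gcdp n d * gcdp n d by rewrite divpK // dvdp_gcdl.
have ed : d = d %/ gcdp n d * gcdp n d by rewrite divpK // dvdp_gcdr.
have q0 : d %/ gcdp n d != 0.
  by apply/eqP => h; move: (d0); rewrite [d in d != 0]ed h mul0r eqxx.
exists (n %/ gcdp n d), (d %/ gcdp n d); split=> //.
- by apply: coprimep_div_gcd; rewrite d0 orbT.
- move: e; rewrite [X in tofrac X * f]ed [X in _ = tofrac X]en !tofracM => e.
  apply: (@mulfI _ (tofrac (d %/ gcdp n d) : ratfun R)); first by rewrite tofrac_eq0.
  rewrite mulrCA mulfV ?tofrac_eq0 // mulr1.
  apply: (@mulIf _ (tofrac (gcdp n d) : ratfun R)); first by rewrite tofrac_eq0.
  by rewrite mulrAC.
- by rewrite !size_divp // leq_sub2r.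
- by apply: (@disk_poly_dvdl _ (gcdp n d)); rewrite -ed.
Qed.

Lemma proper_stableC (a : R) : proper_stable (tofrac a%:P : ratfun R).
Proof.
apply/proper_stableP; exists a%:P, 1; split.
- exact: oner_neq0.
- by rewrite tofrac1 mul1r.
- by rewrite size_poly1 size_polyC leq_b1.
- by move=> s; rewrite rmorph1 (negPf (root1 _)).
Qed.

Lemma proper_stableD (f g : ratfun R) :
  proper_stable f -> proper_stable g -> proper_stable (f + g).
Proof.
move=> /proper_stableP[nf [df [df0 ef sf hf]]].
move=> /proper_stableP[ng [dg [dg0 eg sg hg]]].
apply/proper_stableP; exists (nf * dg + ng * df), (df * dg); split.
- by rewrite mulf_neq0.
- rewrite tofracM tofracD !tofracM -ef -eg mulrDr mulrAC; congr (_ + _).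
  by rewrite [X in X * g]mulrC mulrAC.
- rewrite (leq_trans (size_polyD _ _)) // geq_max; apply/andP; split.
    rewrite (leq_trans (size_polyMleq _ _)) // size_mul //.
    by rewrite -!subn1 leq_sub2r // leq_add2r.
  rewrite (leq_trans (size_polyMleq _ _)) // size_mul //.
  by rewrite -!subn1 leq_sub2r // addnC leq_add2l.
- exact: disk_polyM.
Qed.

Lemma proper_stableM (f g : ratfun R) :
  proper_stable f -> proper_stable g -> proper_stable (f * g).
Proof.
move=> /proper_stableP[nf [df [df0 ef sf hf]]].
move=> /proper_stableP[ng [dg [dg0 eg sg hg]]].
apply/proper_stableP; exists (nf * ng), (df * dg); split.
- by rewrite mulf_neq0.
- by rewrite !tofracM -ef -eg mulrACA.
- rewrite (leq_trans (size_polyMleq _ _)) // size_mul //.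
  by rewrite -!subn1 leq_sub2r // leq_add.
- exact: disk_polyM.
Qed.

Lemma proper_stable0 : proper_stable (0 : ratfun R).
Proof. by have := proper_stableC 0; rewrite tofrac0. Qed.

Lemma proper_stable1 : proper_stable (1 : ratfun R).
Proof. by have := proper_stableC 1; rewrite tofrac1. Qed.

Lemma proper_stableN (f : ratfun R) : proper_stable f -> proper_stable (- f).
Proof.
rewrite -mulN1r; apply: proper_stableM.
by have := proper_stableC (-1); rewrite polyCN tofracN tofrac1.
Qed.

(** * Closure properties of stable transfer matrices *)

Lemma RHoo_const (m n : nat) (M : 'M[R]_(m, n)) : RHoo (constmx M).
Proof. by move=> i j; rewrite mxE; apply: proper_stableC. Qed.

Lemma RHooD (m n : nat) (M N : 'M[ratfun R]_(m, n)) :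
  RHoo M -> RHoo N -> RHoo (M + N).
Proof. by move=> hM hN i j; rewrite mxE; apply: proper_stableD. Qed.

Lemma RHooN (m n : nat) (M : 'M[ratfun R]_(m, n)) : RHoo M -> RHoo (- M).
Proof. by move=> hM i j; rewrite mxE; apply: proper_stableN. Qed.

Lemma RHooB (m n : nat) (M N : 'M[ratfun R]_(m, n)) :
  RHoo M -> RHoo N -> RHoo (M - N).
Proof. by move=> hM hN; apply: RHooD => //; apply: RHooN. Qed.

Lemma RHooM (m n p : nat) (M : 'M[ratfun R]_(m, n)) (N : 'M[ratfun R]_(n, p)) :
  RHoo M -> RHoo N -> RHoo (M *m N).
Proof.
move=> hM hN i j; rewrite mxE.
elim/big_ind: _ => [|f g|k _]; first exact: proper_stable0.
  exact: proper_stableD.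
exact: proper_stableM.
Qed.

Lemma RHoo_block (m1 m2 n1 n2 : nat)
    (M11 : 'M[ratfun R]_(m1, n1)) (M12 : 'M[ratfun R]_(m1, n2))
    (M21 : 'M[ratfun R]_(m2, n1)) (M22 : 'M[ratfun R]_(m2, n2)) :
  RHoo (block_mx M11 M12 M21 M22) <->
  [/\ RHoo M11, RHoo M12, RHoo M21 & RHoo M22].
Proof.
split=> [h | [h11 h12 h21 h22] i j].
  split=> i j.
  - by have := h (lshift _ i) (lshift _ j); rewrite block_mxEul.
  - by have := h (lshift _ i) (rshift _ j); rewrite block_mxEur.
  - by have := h (rshift _ i) (lshift _ j); rewrite block_mxEdl.
  - by have := h (rshift _ i) (rshift _ j); rewrite block_mxEdr.
by case: (split_ordP i) => i' ->; case: (split_ordP j) => j' ->;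
  rewrite ?(block_mxEul, block_mxEur, block_mxEdl, block_mxEdr).
Qed.

Lemma proper_stable_det (n : nat) (M : 'M[ratfun R]_n) :
  RHoo M -> proper_stable (\det M).
Proof.
move=> hM; rewrite /determinant; apply: (big_ind (@proper_stable R)) => [||s _].
- exact: proper_stable0.
- exact: proper_stableD.
apply: proper_stableM.
  have h1 := proper_stableN proper_stable1.
  elim: (nat_of_bool _) => [|k IH]; first by rewrite expr0; apply: proper_stable1.
  by rewrite exprS; apply: proper_stableM.
apply: (big_ind (@proper_stable R)) => [||i _].
- exact: proper_stable1.
- exact: proper_stableM.
- exact: hM.
Qed.

(** Factoring the embedding through polynomial matrices exhibits it as two ring morphisms applied
    entrywise, so the generic [map_mx] lemmas apply. *)
Lemma constmxE (m n : nat) (M : 'M[R]_(m, n)) :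
  constmx M = map_mx (@FracField.tofrac {poly R}) (map_mx polyC M).
Proof. by apply/matrixP=> i j; rewrite !mxE. Qed.

Lemma constmxM (m n p : nat) (M : 'M[R]_(m, n)) (N : 'M[R]_(n, p)) :
  constmx (M *m N) = constmx M *m constmx N.
Proof. by rewrite !constmxE !map_mxM. Qed.

Lemma constmxD (m n : nat) (M N : 'M[R]_(m, n)) :
  constmx (M + N) = constmx M + constmx N.
Proof. by rewrite !constmxE !map_mxD. Qed.

Lemma constmx0 (m n : nat) : constmx (0 : 'M[R]_(m, n)) = 0.
Proof. by rewrite constmxE !map_mx0. Qed.

Lemma constmx1 (n : nat) : constmx (1%:M : 'M[R]_n) = 1%:M.
Proof. by rewrite constmxE !map_mx1. Qed.

Lemma constmx_block (m1 m2 n1 n2 : nat)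
    (M11 : 'M[R]_(m1, n1)) (M12 : 'M[R]_(m1, n2))
    (M21 : 'M[R]_(m2, n1)) (M22 : 'M[R]_(m2, n2)) :
  constmx (block_mx M11 M12 M21 M22) =
  block_mx (constmx M11) (constmx M12) (constmx M21) (constmx M22).
Proof. exact: map_block_mx. Qed.

Lemma constmx_row (m n1 n2 : nat) (M1 : 'M[R]_(m, n1)) (M2 : 'M[R]_(m, n2)) :
  constmx (row_mx M1 M2) = row_mx (constmx M1) (constmx M2).
Proof. exact: map_row_mx. Qed.

Lemma constmx_col (m1 m2 n : nat) (M1 : 'M[R]_(m1, n)) (M2 : 'M[R]_(m2, n)) :
  constmx (col_mx M1 M2) = col_mx (constmx M1) (constmx M2).
Proof. exact: map_col_mx. Qed.

(** * Resolvents and their stability *)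

Definition resolvent (n : nat) (A : 'M[R]_n) : 'M[ratfun R]_n :=
  invmx ((zvar R)%:M - constmx A).

Lemma zI_constmxE (n : nat) (A : 'M[R]_n) :
  (zvar R)%:M - constmx A = map_mx (@FracField.tofrac {poly R}) (char_poly_mx A).
Proof. by rewrite constmxE /char_poly_mx map_mxB map_scalar_mx. Qed.

Lemma det_zI_constmx (n : nat) (A : 'M[R]_n) :
  \det ((zvar R)%:M - constmx A) = tofrac (char_poly A) :> ratfun R.
Proof. by rewrite zI_constmxE det_map_mx. Qed.

Lemma char_poly_neq0 (n : nat) (A : 'M[R]_n) : char_poly A != 0.
Proof. by rewrite -size_poly_gt0 size_char_poly. Qed.

Lemma zI_constmx_unit (n : nat) (A : 'M[R]_n) :
  (zvar R)%:M - constmx A \in unitmx.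
Proof. by rewrite unitmxE det_zI_constmx unitfE tofrac_eq0 char_poly_neq0. Qed.

Lemma mul_resolvent (n : nat) (A : 'M[R]_n) :
  ((zvar R)%:M - constmx A) *m resolvent A = 1%:M.
Proof. by rewrite mulmxV ?zI_constmx_unit. Qed.

Lemma resolvent_mul (n : nat) (A : 'M[R]_n) :
  resolvent A *m ((zvar R)%:M - constmx A) = 1%:M.
Proof. by rewrite mulVmx ?zI_constmx_unit. Qed.

Lemma schurE (n : nat) (A : 'M[R]_n) : schur A <-> disk_poly (char_poly A).
Proof.
by split=> h s; have := h s; rewrite eigenvalue_root_char -map_char_poly.
Qed.

(** Each term of the Leibniz formula is, up to sign, a product of [n] polynomials of degree at most
    1. *)
Lemma size_det_leq (n : nat) (M : 'M[{poly R}]_n) :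
  (forall i j, (size (M i j) <= 2)%N) -> (size (\det M) <= n.+1)%N.
Proof.
move=> hM; rewrite (leq_trans (size_sum _ _ _)) //; apply/bigmax_leqP=> s _.
rewrite -signr_odd; case: (odd _); rewrite ?expr1 ?mulN1r ?size_polyN ?expr0 ?mul1r;
  rewrite (leq_trans (size_poly_prod_leq _ _)) //;
  rewrite leq_subLR [#|_|]card_ord addnS ltnS;
  rewrite (@leq_trans (\sum_(i < n) 2)) ?leq_sum // sum_nat_const card_ord;
  by rewrite muln2 addnn.
Qed.

(** From right to left, Cramer's rule writes each entry as a cofactor over [char_poly A]. The
    converse goes through the determinant, since cancellations in a single entry may hide an
    eigenvalue. *)
Lemma RHoo_resolvent (n : nat) (A : 'M[R]_n) : RHoo (resolvent A) <-> schur A.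
Proof.
rewrite schurE; split=> [h | h i j].
  (* det (z I - A)^-1 = 1 / char_poly A is proper and stable. *)
  have /proper_stableP[num [den [den0 e _ hden]]] := proper_stable_det h.
  move: e; rewrite det_inv det_zI_constmx => e.
  have {}e : den = char_poly A * num.
    apply/eqP; rewrite -tofrac_eq tofracM -e mulrCA mulfV ?mulr1 //.
    by rewrite tofrac_eq0 char_poly_neq0.
  by apply: (@disk_poly_dvdl _ num); rewrite -e.
apply/proper_stableP.
exists (cofactor (char_poly_mx A) j i), (char_poly A); split=> //.
- exact: char_poly_neq0.
- rewrite /resolvent /invmx zI_constmx_unit mxE det_zI_constmx mulrA mulfV ?mul1r.
    by rewrite mxE zI_constmxE cofactor_map_mx.
  by rewrite tofrac_eq0 char_poly_neq0.
- rewrite size_char_poly /cofactor -signr_odd.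
  (* The minor has order [n.-1]; the weaker bound [n.+1], the size of [char_poly A], already gives
     properness. *)
  have hs : (size (\det (row' j (col' i (char_poly_mx A)))) <= n.+1)%N.
    apply: (leq_trans (size_det_leq _)); last by rewrite ltnS leq_pred.
    move=> k l; rewrite !mxE; case: eqP => _; rewrite ?mulr1n ?mulr0n ?sub0r.
      by rewrite size_XsubC.
    by rewrite size_polyN size_polyC (leq_trans (leq_b1 _)).
  by case: (odd _); rewrite ?expr1 ?mulN1r ?size_polyN ?expr0 ?mul1r.
Qed.

(* With H_L, H_F the resolvents of A + L C and A + B F, the resolvent H of A
   satisfies H = H_L - H_L L (C H) and C H = C H_F - (C H B) F H_F. *)
Lemma RHoo_resolvent_stab_det (n m p : nat) (A : 'M[R]_n) (B : 'M[R]_(n, m))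
    (C : 'M[R]_(p, n)) :
  stabilizable A B -> detectable A C ->
  RHoo (constmx C *m resolvent A *m constmx B) -> RHoo (resolvent A).
Proof.
move=> [F /RHoo_resolvent hF] [L /RHoo_resolvent hL] h.
have eL : resolvent A = resolvent (A + L *m C)
    - resolvent (A + L *m C) *m constmx L *m (constmx C *m resolvent A).
  rewrite -[LHS]mul1mx -(resolvent_mul (A + L *m C)) -mulmxA.
  rewrite constmxD constmxM opprD addrA mulmxBl mul_resolvent.
  by rewrite mulmxBr mulmx1 !mulmxA.
have eF : resolvent A = resolvent (A + B *m F)
    - resolvent A *m constmx B *m constmx F *m resolvent (A + B *m F).
  rewrite -[LHS]mulmx1 -(mul_resolvent (A + B *m F)) mulmxA.
  rewrite constmxD constmxM opprD addrA mulmxBr resolvent_mul.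
  by rewrite mulmxBl mul1mx !mulmxA.
rewrite eL; apply: RHooB => //; apply: RHooM.
  by apply: RHooM => //; apply: RHoo_const.
rewrite eF mulmxBr; apply: RHooB; first by apply: RHooM => //; apply: RHoo_const.
rewrite !mulmxA; apply: RHooM => //; apply: RHooM => //; exact: RHoo_const.
Qed.

End StableRationalFunctions.

(** * Realization of the closed-loop responses *)

Section FeedbackInverse.
Variables (F : fieldType) (n m p q : nat).
Variables (X : 'M[F]_n) (B : 'M[F]_(n, m)) (C : 'M[F]_(p, n)).
Variables (Z S : 'M[F]_q) (Bk : 'M[F]_(q, p)) (Ck : 'M[F]_(m, q)) (Dk : 'M[F]_(m, p)).
Variable N : 'M[F]_(n + q).

Let K := Ck *m S *m Bk + Dk.
Let M := block_mx (X - B *m Dk *m C) (- (B *m Ck)) (- (Bk *m C)) Z.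

Hypotheses (SZ : S *m Z = 1%:M) (ZS : Z *m S = 1%:M).
Hypotheses (NM : N *m M = 1%:M) (MN : M *m N = 1%:M).

Let P := ulsubmx N.

(** Block inversion by Schur complement: eliminating the block [Z] of [M] leaves
    [X - B Dk C - B Ck S Bk C], which is [X - B K C]. It is used with [X] and [Z] equal to [z I - A]
    and [z I - Ak], and with [N] the resolvent of the closed loop. *)
Lemma feedback_inverse :
  [/\ invmx (X - B *m K *m C) = P,
      ursubmx N = P *m B *m Ck *m S,
      dlsubmx N = S *m Bk *m C *m P &
      drsubmx N = S + S *m Bk *m C *m P *m B *m Ck *m S].
Proof.
(* The right block column of [N M = 1] determines the right blocks of [N], after multiplication by
   [S]; the left block column of [M N = 1] determines the left blocks. *)
have := NM; rewrite -{1}[N]submxK mulmx_block [1%:M]scalar_mx_block.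
move=> /eq_block_mx[_ e12 _ e22].
have := MN; rewrite -{1}[N]submxK mulmx_block [1%:M]scalar_mx_block.
move=> /eq_block_mx[e11 _ e21 _]; rewrite -/P in e11 e12 e21.
have E21 : dlsubmx N = S *m Bk *m C *m P.
  move: e21; rewrite mulNmx => /eqP; rewrite addrC subr_eq0 => /eqP e21.
  by rewrite -[LHS]mul1mx -SZ -mulmxA e21 !mulmxA.
split=> //.
- have e : (X - B *m K *m C) *m P = 1%:M.
    rewrite -[RHS]e11 E21 mulmxDr mulmxDl opprD addrA addrAC mulmxBl mulNmx.
    by rewrite !mulmxA.
  (* A one-sided inverse of a square matrix is its inverse. *)
  by have [u _] := mulmx1_unit e; rewrite -[LHS]mulmx1 -e mulKmx.
- move: e12; rewrite mulmxN => /eqP; rewrite addrC subr_eq0 => /eqP e12.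
  by rewrite -[LHS]mulmx1 -ZS mulmxA e12 !mulmxA.
- move: e22; rewrite mulmxN => /eqP; rewrite addrC subr_eq => /eqP e22.
  by rewrite -[LHS]mulmx1 -ZS mulmxA e22 mulmxDl mul1mx E21 !mulmxA.
Qed.

Lemma feedback_inverse_xy : P *m B *m K = row_mx 1%:M 0 *m N *m col_mx (B *m Dk) Bk.
Proof.
have [_ E12 E21 E22] := feedback_inverse.
rewrite -[N]submxK E12 E21 E22 -/P mul_row_block mul_row_col !mul1mx !mul0mx !addr0.
by rewrite mulmxDr !mulmxA addrC.
Qed.

Lemma feedback_inverse_ux : K *m C *m P = row_mx (Dk *m C) Ck *m N *m col_mx 1%:M 0.
Proof.
have [_ E12 E21 E22] := feedback_inverse.
rewrite -[N]submxK E12 E21 E22 -/P mul_row_block mul_row_col !mulmx1 !mulmx0 !addr0.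
by rewrite !mulmxDl !mulmxA addrC.
Qed.

Lemma feedback_inverse_uy : K *m (C *m P *m B *m K + 1%:M) =
  row_mx (Dk *m C) Ck *m N *m col_mx (B *m Dk) Bk + Dk.
Proof.
have [_ E12 E21 E22] := feedback_inverse.
rewrite mulmxDr mulmx1 {2}/K addrA; congr (_ + _).
rewrite -[N]submxK E12 E21 E22 -/P mul_row_block mul_row_col.
rewrite /K !mulmxDl !mulmxDr mulmxDl !mulmxA.
(* The first four terms come from expanding both factors [K] in [K C P B K]. The fifth, [Ck S Bk],
   matches the summand [S] of the lower right block of [N]. *)
by rewrite [LHS](AC (2*2*1) ((4*2)*(3*(5*1)))).
Qed.
End FeedbackInverse.

Lemma schur_block_diag (R : realType) (n q : nat) (A : 'M[R]_n) (Ak : 'M[R]_q) :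
  schur A -> schur Ak -> schur (block_mx A 0 0 Ak).
Proof.
move=> /schurE hA /schurE hAk; apply/schurE.
by rewrite /char_poly char_block_diag_mx det_ublock; apply: disk_polyM.
Qed.

Section ClosedLoop.
Variables (R : realType) (n m p q : nat).
Variables (A : 'M[R]_n) (B : 'M[R]_(n, m)) (C : 'M[R]_(p, n)).
Variables (Ak : 'M[R]_q) (Bk : 'M[R]_(q, p)) (Ck : 'M[R]_(m, q)) (Dk : 'M[R]_(m, p)).

(** Substituting [y = C x + dy] and [u = Ck xi + Dk y + du] into the state equations gives this
    matrix, and likewise the input, output and direct matrices below. In particular [dy] drives the
    plant through [Dk] and the controller through [Bk]. *)
Definition loop_mx : 'M[R]_(n + q) :=
  block_mx (A + B *m Dk *m C) (B *m Ck) (Bk *m C) Ak.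

Definition loop_in (b : channel) : 'M[R]_(n + q, chdim n m p b) :=
  match b with
  | chx => col_mx 1%:M 0
  | chy => col_mx (B *m Dk) Bk
  | chu => col_mx B 0
  end.

Definition loop_out (a : channel) : 'M[R]_(chdim n m p a, n + q) :=
  match a with
  | chx => row_mx 1%:M 0
  | chy => row_mx C 0
  | chu => row_mx (Dk *m C) Ck
  end.

Definition loop_direct (a b : channel) : 'M[R]_(chdim n m p a, chdim n m p b) :=
  match a, b with
  | chy, chy => 1%:M
  | chu, chu => 1%:M
  | chu, chy => Dk
  | _, _ => 0
  end.

Local Notation loopPhi := (Phi A B C Ak Bk Ck Dk).

Lemma zI_loop_mx : (zvar R)%:M - constmx loop_mx =
  block_mx ((zvar R)%:M - constmx A - constmx B *m constmx Dk *m constmx C)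
    (- (constmx B *m constmx Ck)) (- (constmx Bk *m constmx C))
    ((zvar R)%:M - constmx Ak).
Proof.
rewrite constmx_block scalar_mx_block opp_block_mx add_block_mx !sub0r.
by rewrite constmxD !constmxM opprD addrA.
Qed.

Lemma Phi_xx : loopPhi chx chx = ulsubmx (resolvent loop_mx).
Proof.
have NM := resolvent_mul loop_mx; have MN := mul_resolvent loop_mx.
rewrite zI_loop_mx in NM MN.
by have [] := feedback_inverse (resolvent_mul Ak) (mul_resolvent Ak) NM MN.
Qed.

Lemma Phi_xb (b : channel) :
  loopPhi chx b = constmx (row_mx 1%:M 0) *m resolvent loop_mx *m constmx (loop_in b).
Proof.
rewrite constmx_row constmx1 constmx0.
case: b; last 2 first.
- have NM := resolvent_mul loop_mx; have MN := mul_resolvent loop_mx.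
  rewrite zI_loop_mx in NM MN; rewrite constmx_col constmxM.
  rewrite -(feedback_inverse_xy (resolvent_mul Ak) (mul_resolvent Ak) NM MN).
  by rewrite -Phi_xx /Phi /transfer -/(resolvent Ak).
- rewrite [LHS](_ : _ = loopPhi chx chx *m constmx B) // Phi_xx.
  rewrite -[resolvent _]submxK constmx_col constmx0 mul_row_block mul_row_col block_mxKul.
  by rewrite !mul1mx !mul0mx mulmx0 !addr0.
- rewrite Phi_xx -[resolvent _]submxK constmx_col constmx0 constmx1.
  rewrite mul_row_block mul_row_col block_mxKul.
  by rewrite !mul1mx !mul0mx mulmx0 !addr0 mulmx1.
Qed.

Lemma Phi_yb (b : channel) :
  loopPhi chy b = constmx C *m loopPhi chx b + constmx (loop_direct chy b).
Proof.
by case: b; rewrite /= ?constmx0 ?constmx1 ?addr0 ?mulmxA.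
Qed.

Lemma Phi_au (a : channel) :
  loopPhi a chu = loopPhi a chx *m constmx B + constmx (loop_direct a chu).
Proof.
by case: a; rewrite /= ?constmx0 ?constmx1 ?addr0.
Qed.

(** Block inversion is needed only for the responses xx, xy, ux and uy; the others follow by
    multiplying with [B] on the right or [C] on the left. *)
Lemma Phi_realization (a b : channel) :
  loopPhi a b = constmx (loop_out a) *m resolvent loop_mx *m constmx (loop_in b)
                + constmx (loop_direct a b).
Proof.
have NM := resolvent_mul loop_mx; have MN := mul_resolvent loop_mx.
rewrite zI_loop_mx in NM MN.
have ux : loopPhi chu chx =
    constmx (loop_out chu) *m resolvent loop_mx *m constmx (loop_in chx).
  rewrite constmx_row constmx_col constmx0 constmx1 constmxM.
  rewrite -(feedback_inverse_ux (resolvent_mul Ak) (mul_resolvent Ak) NM MN).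
  by rewrite -Phi_xx /Phi /transfer -/(resolvent Ak).
case: a => [||].
- by rewrite Phi_xb; case: b; rewrite constmx0 addr0.
- rewrite Phi_yb Phi_xb !mulmxA -constmxM mul_mx_row mulmx1 mulmx0.
  by [].
case: b.
- by rewrite ux constmx0 addr0.
- rewrite constmx_row constmx_col !constmxM.
  rewrite -(feedback_inverse_uy (resolvent_mul Ak) (mul_resolvent Ak) NM MN).
  by rewrite -Phi_xx /Phi /transfer -/(resolvent Ak).
- rewrite Phi_au ux -!mulmxA -constmxM mul_col_mx mul1mx mul0mx.
  by [].
Qed.

Lemma schur_loop_RHoo (a b : channel) : schur loop_mx -> RHoo (loopPhi a b).
Proof.
move=> /RHoo_resolvent h; rewrite Phi_realization; apply: RHooD.
  by apply: RHooM; [apply: RHooM|] => //; apply: RHoo_const.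
exact: RHoo_const.
Qed.

(** The inputs [dy] and [du] can cut the loop. Taking [dy = - C x + Fk xi] makes [y = Fk xi], and
    then [du = F x - (Ck + Dk Fk) xi] makes [u = F x], so plant and controller are stabilized
    separately. *)
Lemma stabilizable_loop : stabilizable A B -> stabilizable Ak Bk ->
  stabilizable loop_mx (row_mx (loop_in chy) (loop_in chu)).
Proof.
move=> [F hF] [Fk hFk].
exists (block_mx (- C) Fk F (- (Ck + Dk *m Fk))).
suff -> : loop_mx + row_mx (loop_in chy) (loop_in chu) *m
    block_mx (- C) Fk F (- (Ck + Dk *m Fk)) = block_mx (A + B *m F) 0 0 (Ak + Bk *m Fk).
  exact: schur_block_diag.
rewrite -block_mxEh mulmx_block add_block_mx; congr block_mx.
- by rewrite mulmxN addrA addrK.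
- by rewrite mulmxN mulmxDr mulmxA opprD addrCA addNKr subrr.
- by rewrite mulmxN mul0mx addr0 subrr.
- by rewrite mul0mx addr0.
Qed.

(** Dually, output injection cuts the loop: [- B u] cancels the controller's action on the plant,
    and [- (Bk + Lk Dk) y] cancels both [Bk y] and the part [Dk y] of [u] injected by [Lk]. *)
Lemma detectable_loop : detectable A C -> detectable Ak Ck ->
  detectable loop_mx (col_mx (loop_out chy) (loop_out chu)).
Proof.
move=> [L hL] [Lk hLk].
exists (block_mx L (- B) (- (Bk + Lk *m Dk)) Lk).
suff -> : loop_mx + block_mx L (- B) (- (Bk + Lk *m Dk)) Lk *m
    col_mx (loop_out chy) (loop_out chu) = block_mx (A + L *m C) 0 0 (Ak + Lk *m Ck).
  exact: schur_block_diag.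
rewrite -block_mxEv mulmx_block add_block_mx; congr block_mx.
- by rewrite mulNmx mulmxA addrA addrAC addrK.
- by rewrite mulNmx mulmx0 add0r subrr.
- by rewrite mulNmx mulmxDl opprD mulmxA addrNK subrr.
- by rewrite mulmx0 add0r.
Qed.

Lemma RHoo_loop_schur :
  stabilizable A B -> stabilizable Ak Bk -> detectable A C -> detectable Ak Ck ->
  RHoo (Phi4 A B C Ak Bk Ck Dk chy chu chy chu) -> schur loop_mx.
Proof.
move=> sA sAk dA dAk h; apply/RHoo_resolvent.
apply: (RHoo_resolvent_stab_det (stabilizable_loop sA sAk) (detectable_loop dA dAk)).
(* The four blocks are the given responses minus their constant direct terms. *)
rewrite constmx_row constmx_col mul_col_mx mul_col_row.
move: h => /RHoo_block [h1 h2 h3 h4]; apply/RHoo_block; split;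
  [move: h1 | move: h2 | move: h3 | move: h4]; rewrite Phi_realization => h;
  rewrite -[X in RHoo X](addrK (constmx (loop_direct _ _)));
  by apply: RHooB; [exact: h | apply: RHoo_const].
Qed.

End ClosedLoop.

(** * Asymptotic stability of linear recurrences *)

Lemma cvg0_seqP (R : realType) (V : normedModType R) (u : nat -> V) :
  (u @ \oo --> (0 : V))%classic <->
  forall e : R, 0 < e -> exists N, forall t, (N <= t)%N -> `|u t| <= e.
Proof.
split=> [/cvgr0Pnorm_le h e /h [N _ hN] | h].
  by exists N => t; apply: hN.
by apply/cvgr0Pnorm_le => e /h [N hN]; exists N.
Qed.

Lemma cvg0_mxP (R : realType) (m n : nat) (x : nat -> 'M[R]_(m, n)) :
  (x @ \oo --> (0 : 'M[R]_(m, n)))%classic <->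
  forall i j, ((fun t => x t i j) @ \oo --> (0 : R))%classic.
Proof.
split=> [h i j | h].
  apply/cvg_ballP => e e0; move/cvg_ballP: h => /(_ e e0).
  by apply: filterS => t [_ /(_ i j)]; rewrite mxE.
apply/cvg_ballP => e e0.
have {}h i j : \forall t \near \oo%classic, ball (0 : R) e (x t i j).
  by move/cvg_ballP: (h i j); apply.
have {}h i : \forall t \near \oo%classic, forall j, ball (0 : R) e (x t i j).
  exact: filter_forall.
have {}h : \forall t \near \oo%classic, forall i j, ball (0 : R) e (x t i j).
  exact: filter_forall.
apply: filterS h => t ht; by split=> // i j; rewrite mxE.
Qed.

Section AutonomousSystems.
Variable R : realType.
Local Notation toC := (real_complex R).
Local Notation normc := (@Normc.normc R).

Lemma normc_ge0 (z : R[i]) : 0 <= normc z.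
Proof. by case: z => a b; apply: sqrtr_ge0. Qed.

Lemma normc_lt1 (z : R[i]) : (`|z| < 1) = (normc z < 1).
Proof. by case: z => a b; rewrite -ltcR. Qed.

Lemma normc_real (a : R) : normc (toC a) = `|a|.
Proof. by rewrite /Normc.normc /= expr0n /= addr0 sqrtr_sqr. Qed.

(** A stable first-order recurrence with vanishing forcing decays: the forcing is eventually small,
    and the transient is geometric. *)
Lemma contraction_cvg0 (r : R) (a g : nat -> R) :
  0 <= r < 1 -> (forall t, 0 <= a t) -> (forall t, a t.+1 <= r * a t + g t) ->
  (g @ \oo --> (0 : R))%classic -> (a @ \oo --> (0 : R))%classic.
Proof.
move=> /andP[r0 r1] a0 ha /cvg0_seqP hg; apply/cvg0_seqP => e e0.
have r1' : 0 < 1 - r by rewrite subr_gt0.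
(* With this bound on the forcing, [e / 2] is the fixed point of the comparison recurrence. *)
have [N hN] := hg (e / 2 * (1 - r)) ltac:(by rewrite !mulr_gt0).
have key k : a (N + k)%N <= a N * r ^+ k + e / 2.
  elim: k => [|k IH]; first by rewrite addn0 expr0 mulr1 lerDl divr_ge0 // ltW.
  rewrite addnS (le_trans (ha _)) //.
  have h1 : r * a (N + k)%N <= r * (a N * r ^+ k + e / 2) by rewrite ler_wpM2l.
  have h2 : g (N + k)%N <= e / 2 * (1 - r).
    by rewrite (le_trans (ler_norm _)) // hN // leq_addr.
  rewrite (le_trans (lerD h1 h2)) // exprS mulrDr mulrBr mulr1 [r * (e / 2)]mulrC.
  by rewrite addrACA addrN addr0 mulrCA.
have hr : `|r| < 1 by rewrite ger0_norm.
have /cvg0_seqP /(_ (e / 2)) [|M hM] := cvg_geometric (a N) hr.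
  by rewrite divr_gt0.
exists (N + M)%N => t ht.
have -> : t = (N + (t - N))%N by rewrite subnKC // (leq_trans _ ht) // leq_addr.
rewrite ger0_norm // (le_trans (key _)) // [leRHS]splitr lerD2r.
have := hM (t - N)%N; rewrite leq_subRL; last by rewrite (leq_trans _ ht) // leq_addr.
by move=> /(_ ht); apply: le_trans; apply: ler_norm.
Qed.

(* The sequence [\prod_(l <- s) (S - l) w], where S is the shift. *)
Definition shift_factors (s : seq R[i]) (w : nat -> R[i]) : nat -> R[i] :=
  foldr (fun l v t => v t.+1 - l * v t) w s.

(** The outermost factor is removed first: if [v t.+1 - l * v t] tends to 0 and [l] lies in the open
    unit disk, the moduli of [v] satisfy [contraction_cvg0] with ratio [normc l]. *)
Lemma shift_factors_cvg0 (s : seq R[i]) (w : nat -> R[i]) :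
  {in s, forall l, `|l| < 1} ->
  ((normc \o shift_factors s w) @ \oo --> (0 : R))%classic ->
  ((normc \o w) @ \oo --> (0 : R))%classic.
Proof.
elim: s => [//|l s IH] hs h; apply: IH.
  by move=> k ks; apply: hs; rewrite inE ks orbT.
apply: (contraction_cvg0 (r := normc l) _ _ _ h) => [|t|t] /=.
- by rewrite normc_ge0 -normc_lt1 hs // inE eqxx.
- exact: normc_ge0.
- rewrite -Normc.normcM addrC (le_trans _ (le_normcD _ _)) //.
  by rewrite subrK.
Qed.

Lemma schur_cvg0 (n : nat) (A : 'M[R]_n) (x : nat -> 'cV[R]_n) :
  schur A -> (forall t, x t.+1 = A *m x t) -> (x @ \oo --> (0 : 'cV[R]_n))%classic.
Proof.
move=> hA hx; apply/cvg0_mxP => i j.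
case: n A x hA hx i => [|n] A x hA hx i; first by case: i.
pose X t := map_mx toC (x t); pose Ac := map_mx toC A.
have hX t : X t.+1 = Ac *m X t by rewrite /X hx map_mxM.
have [s es] := closed_field_poly_normal (char_poly Ac).
rewrite (monicP (char_poly_monic _)) scale1r in es.
have hs : {in s, forall l, `|l| < 1}.
  by move=> l ls; apply: hA; rewrite eigenvalue_root_char es root_prod_XsubC.
(* By Cayley-Hamilton, peeling off the factors of the characteristic polynomial
   one by one ends in the zero sequence. *)
have factorsE (r : seq R[i]) t : shift_factors r (fun t => X t i j) t =
    (horner_mx Ac (\prod_(l <- r) ('X - l%:P)) *m X t) i j.
  elim: r t => [|l r IH] t; first by rewrite big_nil rmorph1 mul1mx.
  rewrite /= !IH big_cons [('X - _) * _]mulrC rmorphM rmorphB /= horner_mx_X horner_mx_C.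
  by rewrite -mulmxE -mulmxA mulmxBl -hX mul_scalar_mx mulmxBr -scalemxAr !mxE.
have := shift_factors_cvg0 (w := fun t => X t i j) hs.
rewrite (_ : normc \o shift_factors s _ = fun=> 0); last first.
  apply/funext => t /=; rewrite factorsE -es Cayley_Hamilton mul0mx mxE.
  exact: Normc.normc0.
move=> /(_ (cvg_cst _)) /cvg0_seqP h; apply/cvg0_seqP => e /h [N hN].
by exists N => t /hN /=; rewrite mxE normc_real normr_id.
Qed.

(** A left eigenvector [v] for [l] gives [v A^t x0 = l^t (v x0)]. A basis vector [x0] on which [v]
    does not vanish is a real initial state, and if [l] had modulus at least 1 its orbit could not
    tend to 0. *)
Lemma cvg0_schur (n : nat) (A : 'M[R]_n) :
  (forall x0 : 'cV[R]_n, ((fun t => iter t (mulmx A) x0) @ \oo --> (0 : 'cV[R]_n))%classic) ->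
  schur A.
Proof.
move=> h l /eigenvalueP [v ev v0].
have [j vj] : exists j, v 0 j != 0.
  by have /rV0Pn [j hj] := v0; exists j.
rewrite normc_lt1 ltNge; apply/negP => l1.
have ex t : l ^+ t * v 0 j =
    \sum_i v 0 i * toC (iter t (mulmx A) (delta_mx j 0 : 'cV[R]_n) i 0).
  have -> : l ^+ t * v 0 j =
      (v *m map_mx toC (iter t (mulmx A) (delta_mx j 0 : 'cV[R]_n))) 0 0.
    elim: t => [|t IH].
      by rewrite expr0 mul1r /= map_delta_mx -colE mxE.
    by rewrite iterS map_mxM mulmxA ev -scalemxAl mxE -IH exprS mulrA.
  by rewrite mxE; apply: eq_bigr => i _; rewrite !mxE.
have vj0 : 0 < normc (v 0 j).
  rewrite lt_def normc_ge0 andbT; apply: contra_neq vj.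
  exact: Normc.eq0_normc.
have hsum : ((fun t =>
    \sum_i normc (v 0 i) * `|iter t (mulmx A) (delta_mx j 0 : 'cV[R]_n) i 0|)
    @ \oo --> \sum_i normc (v 0 i) * 0)%classic.
  have cont : continuous (fun z : R * R => z.1 + z.2).
    by move=> z; apply: add_continuous.
  apply: (cvg_big cont) => i _.
  apply: cvgMl_tmp; apply/norm_cvg0P.
  exact: (cvg0_mxP _).1 (h _) i 0.
have s0 : \sum_i normc (v 0 i) * 0 = 0 by rewrite big1 // => i _; rewrite mulr0.
(* At time [N] the sum is at most half of [normc (v 0 j)], yet it dominates the modulus of
   [l ^+ N * v 0 j], which is at least [normc (v 0 j)]. *)
move: hsum; rewrite s0 => /cvg0_seqP /(_ (normc (v 0 j) / 2)) [|N /(_ N (leqnn N))].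
  by rewrite divr_gt0.
apply/negP; rewrite -ltNge (lt_le_trans (y := normc (v 0 j))) //.
  by rewrite ltr_pdivrMr // mulr2n mulrDr mulr1 ltrDl.
rewrite (le_trans _ (ler_norm _)) //.
apply: (@le_trans _ _ (normc (l ^+ N * v 0 j))).
  rewrite Normc.normcM ler_peMl ?normc_ge0 //.
  elim: N => [|N IH]; first by rewrite expr0 Normc.normc1.
  by rewrite exprS Normc.normcM -[1]mulr1 ler_pM.
rewrite ex; elim/big_ind2: _ => [|a b c d ha hc|i _].
- by rewrite Normc.normc0.
- by rewrite (le_trans (le_normcD _ _)) // lerD.
- by rewrite Normc.normcM normc_real.
Qed.

End AutonomousSystems.

(** The stacked state [(x, xi)] of an undisturbed trajectory obeys the autonomous recurrence of
    [loop_mx], and every orbit of that recurrence arises from such a trajectory. *)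
Lemma internally_stable_schur (R : realType) (n m p q : nat)
    (A : 'M[R]_n) (B : 'M[R]_(n, m)) (C : 'M[R]_(p, n))
    (Ak : 'M[R]_q) (Bk : 'M[R]_(q, p)) (Ck : 'M[R]_(m, q)) (Dk : 'M[R]_(m, p)) :
  internally_stable A B C Ak Bk Ck Dk <-> schur (loop_mx A B C Ak Bk Ck Dk).
Proof.
set M := loop_mx _ _ _ _ _ _ _.
have stepE x xi : M *m col_mx x xi =
    col_mx (A *m x + B *m (Ck *m xi + Dk *m (C *m x))) (Ak *m xi + Bk *m (C *m x)).
  rewrite /M /loop_mx mul_block_col; congr col_mx; last by rewrite mulmxA addrC.
  by rewrite mulmxDl mulmxDr !mulmxA -addrA [X in _ + X]addrC.
split=> [h | h x y u xi hcl].
  apply: cvg0_schur => x0.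
  pose X t := iter t (mulmx M) x0.
  pose x t := usubmx (X t); pose xi t := dsubmx (X t).
  have hX t : X t = col_mx (x t) (xi t) by rewrite vsubmxK.
  have hS t : X t.+1 = M *m X t by [].
  have [hx hxi] : (x @ \oo --> (0 : 'cV[R]_n))%classic /\
      (xi @ \oo --> (0 : 'cV[R]_q))%classic.
    apply: (h x (fun t => C *m x t) (fun t => Ck *m xi t + Dk *m (C *m x t)) xi) => t.
    have := hS t; rewrite !hX stepE => /eq_col_mx [-> ->].
    by rewrite !addr0.
  apply/cvg0_mxP => i j; case: (split_ordP i) => i' ->.
    rewrite (_ : (fun t => _) = fun t => x t i' j); first exact: (cvg0_mxP _).1 hx _ _.
    by apply/funext => t; rewrite -/(X t) hX col_mxEu.
  rewrite (_ : (fun t => _) = fun t => xi t i' j); first exact: (cvg0_mxP _).1 hxi _ _.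
  by apply/funext => t; rewrite -/(X t) hX col_mxEd.
have /cvg0_mxP hX : ((fun t => col_mx (x t) (xi t)) @ \oo --> (0 : 'cV[R]_(n + q)))%classic.
  apply: (schur_cvg0 h) => t; rewrite stepE.
  by have [-> ey -> eu] := hcl t; rewrite eu ey !addr0.
split; apply/cvg0_mxP => i j.
  rewrite (_ : (fun t => _) = fun t => col_mx (x t) (xi t) (lshift _ i) j) //.
  by apply/funext => t; rewrite col_mxEu.
rewrite (_ : (fun t => _) = fun t => col_mx (x t) (xi t) (rshift _ i) j) //.
by apply/funext => t; rewrite col_mxEd.
Qed.

(** * The zero plant *)

Lemma schur0 (R : realType) (n : nat) : schur (0 : 'M[R]_n).
Proof.
move=> l /eigenvalueP [v]; rewrite map_mx0 mulmx0 => /esym /eqP.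
by rewrite scaler_eq0 => /orP [/eqP -> | ->] //; rewrite normr0 ltr01.
Qed.

Section Counterexample.
Variable R : realType.

(** The controller is [K = 1 / (z - 2)]: unstable, but stabilizable and detectable. *)
Local Notation Phi0 := (Phi (0 : 'M[R]_1) (0 : 'M[R]_1) (0 : 'M[R]_1)
  (2%:M : 'M[R]_1) (1%:M : 'M[R]_1) (1%:M : 'M[R]_1) (0 : 'M[R]_1)).

(** With [B = C = 0] the responses are [1 / z] for xx, 1 for yy and uu, [K] for uy, and 0
    otherwise. *)
Lemma RHoo_zero_plant (a b : channel) : ~ (a = chu /\ b = chy) -> RHoo (Phi0 a b).
Proof.
have h0 k l : RHoo (0 : 'M[ratfun R]_(k, l)).
  by move=> i j; rewrite mxE; apply: proper_stable0.
have h1 k : RHoo (1%:M : 'M[ratfun R]_k) by rewrite -constmx1; apply: RHoo_const.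
case: a => [||]; case: b => [||] hab;
  rewrite /Phi constmx0 ?(mulmx0, mul0mx, add0r) //.
- by rewrite subr0 -constmx0; apply/RHoo_resolvent/schur0.
- by case: hab.
Qed.

Lemma zero_plant_unstable : ~ internally_stable (0 : 'M[R]_1) (0 : 'M[R]_1)
  (0 : 'M[R]_1) (2%:M : 'M[R]_1) (1%:M : 'M[R]_1) (1%:M : 'M[R]_1) (0 : 'M[R]_1).
Proof.
move=> /internally_stable_schur /(_ 2); rewrite /loop_mx !mul0mx mulmx0 addr0.
rewrite map_block_mx !map_mx0 map_scalar_mx rmorph_nat => h.
have ev : eigenvalue (block_mx (0 : 'M[R[i]]_1) 0 0 (2%:M : 'M[R[i]]_1)) 2.
  (* This left eigenvector selects the controller state, which doubles at each step. *)
  apply/eigenvalueP; exists (row_mx 0 1%:M).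
    by rewrite mul_row_block !mul0mx !mulmx0 !addr0 add0r mul1mx scale_row_mx scaler0 scalemx1.
  apply/eqP => /eqP; rewrite -row_mx0 => /eqP /eq_row_mx [_ /matrixP /(_ 0 0)].
  by rewrite !mxE => /eqP; rewrite oner_eq0.
by have := h ev; rewrite normr_nat ltrn1.
Qed.

Lemma zero_plant_not_sufficient (b b' a a' : channel) :
  (forall c d, c = a \/ c = a' -> d = b \/ d = b' -> ~ (c = chu /\ d = chy)) ->
  not_sufficient R b b' a a'.
Proof.
move=> h; exists 1, 1, 1, 1, 0, 0, 0, 2%:M, 1%:M, 1%:M, 0.
(* The gain [-2] moves the controller eigenvalue to 0, both by state feedback and by output
   injection. *)
have s0 : schur (2%:M - 2%:M : 'M[R]_1) by rewrite subrr; apply: schur0.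
split=> //.
- split; first by exists 0; rewrite mulmx0 addr0; apply: schur0.
  by exists (- 2%:M); rewrite mul1mx.
- split; first by exists 0; rewrite mul0mx addr0; apply: schur0.
  by exists (- 2%:M); rewrite mulmx1.
- by apply/RHoo_block; split; apply: RHoo_zero_plant; apply: h; auto.
- exact: zero_plant_unstable.
Qed.

End Counterexample.

Theorem theorem1 (R : realType) :
  (forall (n m p q : nat)
     (A : 'M[R]_n) (B : 'M[R]_(n, m)) (C : 'M[R]_(p, n))
     (Ak : 'M[R]_q) (Bk : 'M[R]_(q, p)) (Ck : 'M[R]_(m, q)) (Dk : 'M[R]_(m, p)),
     stabilizable A B -> stabilizable Ak Bk ->
     detectable A C -> detectable Ak Ck ->
     [<-> internally_stable A B C Ak Bk Ck Dk;
          RHoo (Phi4 A B C Ak Bk Ck Dk chx chy chy chu);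
          RHoo (Phi4 A B C Ak Bk Ck Dk chx chy chx chu);
          RHoo (Phi4 A B C Ak Bk Ck Dk chy chu chy chu);
          RHoo (Phi4 A B C Ak Bk Ck Dk chy chu chx chu)])
  /\ [/\ not_sufficient R chx chy chx chy,
         not_sufficient R chy chu chx chy,
         not_sufficient R chx chu chx chy,
         not_sufficient R chx chu chy chu &
         not_sufficient R chx chu chx chu].
Proof.
split; last first.
  (* Each of the five groups lacks either the signal [chu] or the disturbance [chy]. *)
  by split; apply: zero_plant_not_sufficient => c d [-> | ->] [-> | ->] [].
move=> n m p q A B C Ak Bk Ck Dk sA sAk dA dAk.
have all4 b b' a a' : internally_stable A B C Ak Bk Ck Dk ->
    RHoo (Phi4 A B C Ak Bk Ck Dk b b' a a').
  move=> /internally_stable_schur h.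
  by apply/RHoo_block; split; apply: schur_loop_RHoo.
have stab : RHoo (Phi4 A B C Ak Bk Ck Dk chy chu chy chu) ->
    internally_stable A B C Ak Bk Ck Dk.
  by move=> h; apply/internally_stable_schur; apply: RHoo_loop_schur.
have right a : RHoo (Phi A B C Ak Bk Ck Dk a chx) -> RHoo (Phi A B C Ak Bk Ck Dk a chu).
  move=> h; rewrite Phi_au; apply: RHooD; last exact: RHoo_const.
  by apply: RHooM => //; apply: RHoo_const.
have left b : RHoo (Phi A B C Ak Bk Ck Dk chx b) -> RHoo (Phi A B C Ak Bk Ck Dk chy b).
  move=> h; rewrite Phi_yb; apply: RHooD; last exact: RHoo_const.
  by apply: RHooM => //; apply: RHoo_const.
(* In the cycle, every implication after the first recovers the group [(dy, du) -> (y, u)] and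
   returns to internal stability through [stab]. *)
tfae.
- exact: all4.
- move=> /RHoo_block [h1 h2 h3 h4]; apply/all4/stab/RHoo_block.
  by split=> //; apply: right.
- move=> /RHoo_block [h1 h2 h3 h4]; apply/all4/stab/RHoo_block.
  by split=> //; [apply: left | apply/left/right | apply: right].
- by move=> /stab; apply: all4.
- move=> /RHoo_block [h1 h2 h3 h4]; apply/stab/RHoo_block.
  by split=> //; apply: left.
Qed.
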